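(* Let $p$ be a prime number and $G=\mathbb{Z}_{p^2}\times\mathbb{Z}_{p^2}$. Then the spectrum of $\mathscr{P}(G)$ (as a multiset) consists of: 1. $-1$ with multiplicity $p^4-p^2-2p-2$; 2. $p^2-p-1$ with multiplicity $p^2-1$; 3. $\frac12\big(p^2\pm(p-1)\sqrt{5p^2-2p+1}-3\big)$, each of the two values with multiplicity $p$; 4. the (three) roots, counted with multiplicity, of the polynomial $$x^3+(3-p^2)x^2+(-2p^4+3p^3-4p^2+p+3)x-p^5+p^4-2p^2+p+1.$$
   Context: For a finite group $G$, the power graph $\mathscr{P}(G)$ is the simple graph with vertex set $G$ in which two distinct vertices $x,y$ are adjacent iff $x=y^k$ or $y=x^k$ for some $k\in\mathbb{N}$. The spectrum of a graph is the multiset of eigenvalues of its adjacency matrix. The spectrum is the multiset union of the listed items (multiplicities add if values in different items coincide). *)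

(* Defs.v *)
From HB Require Import structures.
From mathcomp Require Import all_boot all_order all_fingroup all_algebra.
From mathcomp Require Import boolp.

Set Implicit Arguments.
Unset Strict Implicit.
Unset Printing Implicit Defensive.

Import Order.TTheory GRing.Theory Num.Theory.

Local Open Scope ring_scope.

Definition power_graph (gT : finGroupType) : rel gT := fun x y =>
  `[< x <> y /\
      ((exists k : nat, x = (y ^+ k)%g) \/ (exists k : nat, y = (x ^+ k)%g)) >].

(* The vertices are numbered by [enum_val]; another numbering conjugates the
   matrix by a permutation matrix. *)
Definition adjacency_mx (R : nzRingType) (T : finType) (e : rel T) :
    'M[R]_#|T| :=
  \matrix_(i, j) (e (enum_val i) (enum_val j))%:R.

(* The roots of [q] with multiplicity: [q] is [lead_coef q] times the product
   of the ['X - z%:P] for [z] in this list. The order of the list is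
   unspecified, so it is only meaningful up to [perm_eq]. *)
Definition roots_mult (F : closedFieldType) (q : {poly F}) : seq F :=
  sval (closed_field_poly_normal q).

(* The eigenvalues with algebraic multiplicity, up to [perm_eq]. *)
Definition mx_spectrum (F : closedFieldType) (n : nat) (A : 'M[F]_n) : seq F :=
  roots_mult (char_poly A).

Definition graph_spectrum (F : closedFieldType) (T : finType) (e : rel T) :
    seq F :=
  mx_spectrum (adjacency_mx F e).

(* Main.v *)
Require Import Defs.
From HB Require Import structures.
From mathcomp Require Import all_boot all_order all_fingroup all_algebra.
From mathcomp Require Import cyclic boolp zify ring.

(* Let [A] be the adjacency matrix. Two elements are equal or adjacent iff the
   cyclic subgroups they generate are comparable, so [A + 1 = U M U^T] where
   [U] is the incidence matrix between elements and the cyclic subgroups they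
   generate, and [M] is the comparability matrix of the cyclic subgroups. By
   Sylvester's identity the characteristic polynomial of [A + 1] is, up to a
   power of [t], that of [M U^T U]. There are [p (p + 1)] cyclic subgroups of
   order [p^2], [p + 1] of order [p], and the trivial one; each subgroup of
   order [p^2] contains exactly one of order [p], and each subgroup of order
   [p] lies in exactly [p] of order [p^2]. Hence, taking the subgroups of order
   [p^2] first and those of order [p] next, each Schur complement inverts only
   a scalar matrix. The excluded values of [t], where such a scalar vanishes,
   are finitely many, so they do not affect the polynomial identity. *)

Set Implicit Arguments.
Unset Strict Implicit.
Unset Printing Implicit Defensive.

Import Order.TTheory GRing.Theory Num.Theory.

Local Open Scope ring_scope.

(** * Determinants: Schur complement of a scalar block and Sylvester's identity *)

(** Right multiplication by a unipotent block matrix clears [B] and leaves the Schur complement in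
    place of [A]. *)
Lemma det_block_scalar (F : fieldType) (n1 n2 : nat) (d : F)
    (B : 'M_(n1, n2)) (C : 'M_(n2, n1)) (A : 'M_n2) : d != 0 ->
  \det (block_mx d%:M B C A) = d ^+ n1 * \det (A - d^-1 *: (C *m B)).
Proof.
move=> d0; rewrite -(det_scalar n1 d) -(det_lblock _ C).
have <- : block_mx d%:M B C A *m block_mx 1%:M (- d^-1 *: B) 0 1%:M
    = block_mx d%:M 0 C (A - d^-1 *: (C *m B)).
  rewrite mulmx_block !mulmx1 !mulmx0 !addr0 mul_scalar_mx scalerA.
  by rewrite mulrN divff // scaleN1r addNr -scalemxAr scaleNr addrC.
by rewrite det_mulmx det_ublock !det1 !mulr1.
Qed.

(** Both sides come from [block_mx t%:M U V 1%:M], eliminated once from its lower right block and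
    once from its upper left one. *)
Lemma det_scalar_sub_mulmx (F : fieldType) (n k : nat) (t : F)
    (U : 'M_(n, k)) (V : 'M_(k, n)) : t != 0 ->
  t ^+ k * \det (t%:M - U *m V) = t ^+ n * \det (t%:M - V *m U).
Proof.
move=> t0.
have -> : \det (t%:M - U *m V) = \det (block_mx t%:M U V 1%:M).
  have: block_mx t%:M U V 1%:M *m block_mx 1%:M 0 (- V) 1%:M
      = block_mx (t%:M - U *m V) U 0 1%:M.
    by rewrite mulmx_block !mulmx1 !mulmx0 !add0r mulmxN mul1mx subrr.
  move/(congr1 (fun A => \det A)).
  by rewrite det_mulmx det_lblock det_ublock !det1 !mulr1.
rewrite det_block_scalar // mulrCA -detZ scalerBr scalerA divff // scale1r.
by rewrite -mul_scalar_mx mulmx1.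
Qed.

(** * The characteristic polynomial of a three-level comparability matrix *)

Section RootedQuotient.
Variables (F : fieldType) (n l b : nat).
Variables (UL : 'M[F]_(n, l)) (UB : 'M[F]_(n, b)) (UR : 'M[F]_(n, 1)).
Variables (P : 'M[F]_(l, b)) (q m r : F).

Local Notation one k := (const_mx 1 : 'cV[F]_k).

(* The roles of the blocks: [UL], [UB], [UR] record which cyclic subgroup of
   order [p^2], [p], [1] an element generates, [P] which subgroups of order
   [p^2] contain which of order [p]. *)
Definition rooted_mx : 'M_n :=
  UL *m UL^T + UB *m UB^T + UR *m UR^T
  + (UL *m P *m UB^T + UB *m P^T *m UL^T)
  + (UL *m one l *m UR^T + UR *m (one l)^T *m UL^T)
  + (UB *m one b *m UR^T + UR *m (one b)^T *m UB^T).

Hypotheses (hL : UL^T *m UL = q%:M) (hB : UB^T *m UB = m%:M).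
Hypotheses (hR : UR^T *m UR = 1%:M) (hLB : UL^T *m UB = 0).
Hypotheses (hLR : UL^T *m UR = 0) (hBR : UB^T *m UR = 0).
Hypotheses (hP : P^T *m P = r%:M) (hP1 : P *m one b = one l).

Lemma det_rooted_mx (t : F) :
    t != 0 -> t - q != 0 -> t - m - r * q * m / (t - q) != 0 ->
  t ^+ (l + (b + 1)) * \det (t%:M - rooted_mx) =
  t ^+ n * ((t - q) ^+ l * ((t - m - r * q * m / (t - q)) ^+ b *
   (t - 1 - r * b%:R * q / (t - q)
    - b%:R * m * (1 + r * q / (t - q)) ^+ 2 / (t - m - r * q * m / (t - q))))).
Proof.
move=> t0 tq0 d0.
set d := t - m - _ in d0 *.
(* [V] is [M *m U^T], where [M] has the block rows [1, P, one l], then [P^T, 1, one b], then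
   [(one l)^T, (one b)^T, 1]. *)
pose U := row_mx UL (row_mx UB UR).
pose V := col_mx (UL^T + P *m UB^T + one l *m UR^T)
  (col_mx (P^T *m UL^T + UB^T + one b *m UR^T)
          ((one l)^T *m UL^T + (one b)^T *m UB^T + UR^T)).
have -> : rooted_mx = U *m V.
  rewrite /U /V !mul_row_col !mulmxDr !mulmxA /rooted_mx.
  set a1 := UL *m _; set a2 := UB *m _; set a3 := UR *m _.
  rewrite !addrA.
  set a4 := UL *m P *m _; set a5 := UB *m P^T *m _.
  set a6 := UL *m one l *m _; set a7 := UR *m _ *m UL^T.
  set a8 := UB *m one b *m _; set a9 := UR *m _ *m UB^T.
  by apply/matrixP=> i j; rewrite !mxE; ring.
rewrite det_scalar_sub_mulmx //; congr (_ * _).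
have hBL : UB^T *m UL = 0 by rewrite -[LHS]trmxK trmx_mul trmxK hLB trmx0.
have hRL : UR^T *m UL = 0 by rewrite -[LHS]trmxK trmx_mul trmxK hLR trmx0.
have hRB : UR^T *m UB = 0 by rewrite -[LHS]trmxK trmx_mul trmxK hBR trmx0.
(* By the orthogonality hypotheses [U^T *m U] is block diagonal with blocks [q], [m], [1], so
   [V *m U] is [M] with its block columns scaled by these. *)
have -> : t%:M - V *m U = block_mx (t - q)%:M (row_mx (- m *: P) (- one l))
    (col_mx (- q *: P^T) (- q *: (one l)^T))
    (block_mx (t - m)%:M (- one b) (- m *: (one b)^T) (t - 1)%:M).
  rewrite /V /U !mul_col_row !mul_col_mx !mul_mx_row !mulmxDl -!mulmxA.
  rewrite hL hB hR hLB hLR hBR hBL hRL hRB !mulmx0 !mulmx1 !addr0 !add0r.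
  rewrite !mul_mx_scalar !scalar_mx_block !opp_block_mx.
  rewrite !opp_row_mx !opp_col_mx !add_block_mx.
  by rewrite !raddfB /= !add0r !scaleNr.
rewrite det_block_scalar //; congr (_ * _).
have one1 k : (one k)^T *m one k = k%:R%:M.
  apply/matrixP=> i j; rewrite !mxE (eq_bigr (fun=> 1)) => [|h _]; last first.
    by rewrite !mxE mulr1.
  by rewrite sumr_const card_ord !ord1 eqxx mulr1n.
have hP1' : P^T *m one l = r *: one b by rewrite -hP1 mulmxA hP mul_scalar_mx.
have h1P : (one l)^T *m P = r *: (one b)^T.
  by rewrite -[LHS]trmxK trmx_mul trmxK hP1' linearZ.
have h11 : (one l)^T *m one l = (r * b%:R)%:M.
  by rewrite -{2}hP1 mulmxA h1P -scalemxAl one1 scale_scalar_mx.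
set c := r * q / (t - q).
rewrite mul_col_row scale_block_mx opp_block_mx add_block_mx.
(* Since [P^T *m P] is scalar, this block stays scalar, which allows a second scalar elimination. *)
have -> : (t - m)%:M - (t - q)^-1 *: (- q *: P^T *m (- m *: P)) = d%:M.
  rewrite -!scalemxAl -!scalemxAr hP !scale_scalar_mx -raddfB /=.
  by congr (_%:M); rewrite /d; field.
have -> : - one b - (t - q)^-1 *: (- q *: P^T *m - one l) = - (1 + c) *: one b.
  rewrite -scalemxAl mulmxN hP1'.
  by apply/matrixP=> i j; rewrite !mxE /c; field.
have -> : - m *: (one b)^T - (t - q)^-1 *: (- q *: (one l)^T *m (- m *: P))
    = - m * (1 + c) *: (one b)^T.
  rewrite -!scalemxAl -!scalemxAr h1P.
  by apply/matrixP=> i j; rewrite !mxE /c; field.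
have -> : (t - 1)%:M - (t - q)^-1 *: (- q *: (one l)^T *m - one l)
    = (t - 1 - r * b%:R * q / (t - q))%:M :> 'M_1.
  rewrite -scalemxAl mulmxN h11.
  by apply/matrixP=> i j; rewrite !mxE !ord1 eqxx !mulr1n; field.
rewrite det_block_scalar //; congr (_ * _).
rewrite -!scalemxAl -!scalemxAr one1 !scale_scalar_mx -raddfB /= det_scalar1.
by rewrite -/c; clearbody c d; field; rewrite d0 tq0.
Qed.
End RootedQuotient.

Lemma horner_char_poly (R : comNzRingType) n (A : 'M[R]_n) (x : R) :
  (char_poly A).[x] = \det (x%:M - A).
Proof.
rewrite -horner_evalE -det_map_mx; congr (\det _); apply/matrixP=> i j.
by rewrite !mxE /= horner_evalE hornerD hornerN hornerMn hornerX hornerC.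
Qed.

(** * Cyclic subgroups, their generators and the incidence matrices *)

Section CyclicSubgroups.
Variable gT : finGroupType.
Implicit Types (k : nat) (x y : gT) (H : {set gT}).

Definition cyclic_subgroups k : {set {set gT}} :=
  [set <[x]>%g | x in [set x : gT | #[x]%g == k]].

Lemma mem_cyclic_subgroups k x :
  (<[x]>%g \in cyclic_subgroups k) = (#[x]%g == k).
Proof.
apply/imsetP/idP=> [[y] | kx]; last by exists x; rewrite ?inE.
by rewrite inE /order => /eqP <- ->.
Qed.

Lemma cyclic_subgroupsP k H :
  reflect (exists2 x, #[x]%g = k & H = <[x]>%g) (H \in cyclic_subgroups k).
Proof.
apply: (iffP imsetP) => -[x]; first by rewrite inE => /eqP; exists x.
by move=> kx ->; exists x; rewrite // inE kx.
Qed.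

Lemma card_generators k H : H \in cyclic_subgroups k ->
  #|[set x | <[x]>%g == H]| = totient k.
Proof.
case/cyclic_subgroupsP=> x <- ->; rewrite totient_gen.
by apply: eq_card => y; rewrite !inE /generator eq_sym.
Qed.

(** The elements are partitioned by the subgroup they generate, and each class has [totient k]
    members. *)
Lemma card_order k :
  #|[set x : gT | #[x]%g == k]| = (#|cyclic_subgroups k| * totient k)%N.
Proof.
rewrite -sum1_card (partition_big_imset (fun x => <[x]>%g)) /=.
rewrite -[RHS]sum_nat_const; apply: eq_bigr => H HA.
rewrite -(card_generators HA) -sum1_card; apply: eq_bigl => x; rewrite !inE.
by rewrite -mem_cyclic_subgroups andbC; case: eqP => // ->.
Qed.

Lemma cycle_sub_ltF x y : (#[x]%g < #[y]%g)%N ->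
  (<[y]> \subset <[x]>)%g = false.
Proof.
by move=> xy; apply: contraTF xy => /subset_leq_card; rewrite ltnNge negbK.
Qed.

Lemma cycle_eqF x y : #[x]%g <> #[y]%g -> (<[x]>%g == <[y]>%g) = false.
Proof. by move=> xy; apply/eqP=> xy'; apply: xy; rewrite !orderE xy'. Qed.

Lemma cycle_sub1 x y : #[x]%g = 1%N -> (<[x]> \subset <[y]>)%g.
Proof. by move=> /eqP; rewrite order_eq1 => /eqP ->; rewrite cycle1 sub1G. Qed.

Lemma cycle_sub_eq x y : #[x]%g = #[y]%g ->
  (<[x]> \subset <[y]>)%g = (<[x]>%g == <[y]>%g).
Proof. by move=> xy; rewrite eqEcard -!orderE xy leqnn andbT. Qed.

(** In a finite group the natural powers of [y] already exhaust [<[y]>]. *)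
Lemma power_graphE x y :
  power_graph x y =
  (x != y) && ((<[x]> \subset <[y]>) || (<[y]> \subset <[x]>))%g.
Proof.
rewrite !cycle_subG.
apply/(asboolP _)/andP=> [[/eqP xy h] | [/eqP xy h]]; split=> //.
  by apply/orP; case: h => -[k ->]; [left | right]; apply: mem_cycle.
by case/orP: h => /cycleP[k h]; [left | right]; exists k.
Qed.

Variable F : fieldType.

Definition generator_mx k : 'M[F]_(#|gT|, #|cyclic_subgroups k|) :=
  \matrix_(i, j) (<[enum_val i]>%g == enum_val j)%:R.

Definition subset_mx k k' :
    'M[F]_(#|cyclic_subgroups k|, #|cyclic_subgroups k'|) :=
  \matrix_(i, j) ((enum_val j : {set gT}) \subset (enum_val i : {set gT}))%:R.

(** At most one index, the one of [<[x]>], contributes; it exists exactly when [x] has order [k].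
    This evaluates the products of incidence matrices entry by entry. *)
Lemma sum_generator_mx k x (f : {set gT} -> F) :
  \sum_(j < #|cyclic_subgroups k|) (<[x]>%g == enum_val j)%:R * f (enum_val j)
  = (#[x]%g == k)%:R * f <[x]>%g.
Proof.
rewrite -(big_enum_val (A := mem (cyclic_subgroups k))
  (fun H => (<[x]>%g == H)%:R * f H)) /=.
rewrite -mem_cyclic_subgroups; have [xA | xA] := boolP (_ \in _); last first.
  rewrite mul0r big1 // => H HA; case: eqP => [xH|]; rewrite ?mul0r //.
  by rewrite xH HA in xA.
rewrite (bigD1 <[x]>%g) //= eqxx big1 ?addr0 // => H /andP[_].
by rewrite eq_sym => /negPf->; rewrite mul0r.
Qed.

(** Distinct columns have disjoint supports, since an element generates only one subgroup. *)
Lemma generator_mx_tr k :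
  (generator_mx k)^T *m generator_mx k = (totient k)%:R%:M.
Proof.
apply/matrixP=> i j; rewrite !mxE.
under eq_bigr do rewrite !mxE -natrM mulnb.
rewrite -(big_enum_val (A := mem gT) (fun x => ((<[x]>%g == enum_val i) &&
  (<[x]>%g == enum_val j))%:R : F)) /=.
have [-> | ij] := eqVneq i j.
  rewrite mulr1n -(card_generators (enum_valP j)) -sum1_card natr_sum.
  rewrite [RHS]big_mkcond; apply: eq_bigr => x _.
  by rewrite andbb inE; case: eqP.
rewrite mulr0n big1 // => x _; case: eqP => //= ->.
by rewrite (inj_eq enum_val_inj) (negPf ij).
Qed.

Lemma generator_mx_tr0 k k' : k != k' ->
  (generator_mx k)^T *m generator_mx k' = 0.
Proof.
move=> /eqP kk'; apply/matrixP=> i j; rewrite !mxE big1 // => h _.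
rewrite !mxE -natrM mulnb; case: andP => // -[/eqP ei /eqP ej].
have := enum_valP i; have := enum_valP j.
by rewrite -ei -ej !mem_cyclic_subgroups => /eqP e /eqP; rewrite e => /esym.
Qed.

Lemma generator_mx_mul_tr k i j :
  (generator_mx k *m (generator_mx k)^T) i j =
  ((#[enum_val i]%g == k) && (<[enum_val i]>%g == <[enum_val j]>%g))%:R.
Proof.
rewrite !mxE; under eq_bigr do rewrite !mxE.
rewrite (sum_generator_mx _ _ (fun H => (<[enum_val j]>%g == H)%:R)).
by rewrite -natrM mulnb [in X in _ && X]eq_sym.
Qed.

Lemma generator_subset_mx k k' i j :
  (generator_mx k *m subset_mx k k' *m (generator_mx k')^T) i j =
  [&& #[enum_val i]%g == k, #[enum_val j]%g == k' &
      <[enum_val j]>%g \subset <[enum_val i]>%g]%:R.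
Proof.
rewrite -mulmxA !mxE.
(* [f] is the value of the sum over the subgroups of order [k']; the sum over those of order [k]
   then evaluates [f] at the subgroup generated by [enum_val i]. *)
pose f H := (#[enum_val j]%g == k')%:R * (<[enum_val j]>%g \subset H)%:R : F.
rewrite (eq_bigr (fun h => (<[enum_val i]>%g == enum_val h)%:R
                           * f (enum_val h))) => [|h _].
  by rewrite (sum_generator_mx _ _ f) /f -!natrM !mulnb.
rewrite !mxE; congr (_ * _).
under eq_bigr do rewrite !mxE mulrC.
exact: (sum_generator_mx _ _ (fun H => (H \subset (enum_val h : {set gT}))%:R)).
Qed.

Lemma generator_mx1 k i j :
  (generator_mx k *m const_mx 1 : 'cV_#|gT|) i j = (#[enum_val i]%g == k)%:R.
Proof.
rewrite !mxE; under eq_bigr do rewrite !mxE.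
by rewrite (sum_generator_mx _ _ (fun=> 1)) mulr1.
Qed.

(** The incidence column of the trivial subgroup, given width literally 1 instead of
    [#|cyclic_subgroups gT 1|]. *)
Definition identity_mx : 'cV[F]_#|gT| := \col_i (enum_val i == 1%g)%:R.

Lemma generator_mx_tr_identity k : k != 1%N ->
  (generator_mx k)^T *m identity_mx = 0.
Proof.
move=> k1; apply/matrixP=> i j; rewrite !mxE big1 // => h _.
rewrite !mxE -natrM mulnb; case: andP => // -[/eqP ei /eqP e1].
have := enum_valP i; rewrite -ei mem_cyclic_subgroups e1 order1 eq_sym.
by rewrite (negPf k1).
Qed.

Lemma identity_mx_tr : identity_mx^T *m identity_mx = 1%:M.
Proof.
apply/matrixP=> i j; rewrite !mxE.
under eq_bigr do rewrite !mxE -natrM mulnb andbb.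
rewrite -(big_enum_val (A := mem gT) (fun x => (x == 1%g)%:R : F)) /=.
rewrite (bigD1 1%g) //= eqxx big1 ?addr0 ?ord1 ?eqxx // => x.
by move=> /negPf ->.
Qed.

End CyclicSubgroups.

(** * Counting in an abelian group of order [p ^ 4] killed by [p ^ 2], with [p ^ 2] elements killed
    by [p] *)

Section Homocyclic.
Variables (gT : finGroupType) (p : nat).
Hypotheses (p_prime : prime p) (mulgC : forall x y : gT, (x * y = y * x)%g).
Hypotheses (cardG : #|gT| = (p ^ 4)%N).
Hypotheses (expG : forall x : gT, (x ^+ (p ^ 2) = 1)%g).
Hypotheses (cardK : #|[set x : gT | x ^+ p == 1]%g| = (p ^ 2)%N).
Implicit Types x y : gT.

Let p_gt1 := prime_gt1 p_prime.

Let p_lt_p2 : (p < p ^ 2)%N. Proof. by rewrite -{1}(expn1 p) ltn_exp2l. Qed.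
Let p2_ndvd_p : (p ^ 2 %| p)%N = false.
Proof. by rewrite gtnNdvd // prime_gt0. Qed.

Lemma order_cases x : [\/ #[x]%g = 1%N, #[x]%g = p | #[x]%g = (p ^ 2)%N].
Proof.
have := order_dvdn x (p ^ 2); rewrite expG eqxx => /(dvdn_pfactor _ _ p_prime).
by case=> -[|[|[|//]]] _ ->; [constructor 1 | constructor 2 | constructor 3].
Qed.

Lemma order_expp x : #[x]%g = (p ^ 2)%N -> #[x ^+ p]%g = p.
Proof.
by move=> xo; rewrite orderXdiv xo ?dvdn_mulr // mulKn // prime_gt0.
Qed.

Lemma order_of_expp x : #[x ^+ p]%g = p -> #[x]%g = (p ^ 2)%N.
Proof.
case: (order_cases x) => // xo.
  by move: xo => /eqP; rewrite order_eq1 => /eqP ->; rewrite expg1n order1; lia.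
by rewrite -{1}xo expg_order order1; lia.
Qed.

(** A nonempty fibre of the homomorphism [x ^+ p] is a coset of its kernel. *)
Lemma card_root_fiber y : y \in [set x ^+ p | x : gT]%g ->
  #|[set x : gT | x ^+ p == y]%g| = (p ^ 2)%N.
Proof.
case/imsetP=> x0 _ ->; rewrite -cardK -[RHS](card_imset _ (mulgI x0)).
apply: eq_card => x; rewrite inE; apply/eqP/imsetP=> [xx0 | [z]].
  exists (x0^-1 * x)%g; last by rewrite mulKVg.
  rewrite inE expgMn; last exact: mulgC.
  by rewrite xx0 expgVn mulVg.
rewrite inE => /eqP z1 ->; rewrite expgMn; last exact: mulgC.
by rewrite z1 mulg1.
Qed.

(** The exponent puts the image inside the kernel. The fibres over the image have [p ^ 2] elements
    each and cover all [p ^ 4], so the two have the same size. *)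
Lemma image_expp : [set x ^+ p | x : gT]%g = [set x : gT | x ^+ p == 1]%g.
Proof.
apply/eqP; rewrite eqEcard; apply/andP; split.
  apply/subsetP=> _ /imsetP[x _ ->]; rewrite inE -expgM.
  by rewrite -[(p * p)%N]/(p ^ 2)%N expG.
rewrite cardK -(@leq_pmul2r (p ^ 2)) ?expn_gt0 ?(ltnW p_gt1) //.
rewrite -expnD -cardG -sum_nat_const -sum1_card.
rewrite (partition_big_imset (fun x => x ^+ p)%g) /=.
apply: eq_leq; apply: eq_bigr => y /card_root_fiber <-.
by rewrite -sum1_card; apply: eq_bigl => x; rewrite inE.
Qed.

Local Notation cyc := (cyclic_subgroups gT).

Lemma card_order_p : #|[set x : gT | #[x]%g == p]| = (p ^ 2 - 1)%N.
Proof.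
rewrite -cardK [in RHS](cardsD1 1%g) !inE expg1n eqxx add1n subn1 /=.
apply: eq_card => x; rewrite !inE -order_eq1 -order_dvdn.
by case: (order_cases x) => ->; rewrite ?dvd1n ?dvdnn ?p2_ndvd_p ?eqxx //; lia.
Qed.

Lemma card_order_p2 : #|[set x : gT | #[x]%g == p ^ 2]%N| = (p ^ 4 - p ^ 2)%N.
Proof.
rewrite -cardK -cardG -(cardsC [set x : gT | x ^+ p == 1]%g) addKn.
apply: eq_card => x; rewrite !inE -order_dvdn.
case: (order_cases x) => ->; rewrite ?dvd1n ?dvdnn ?p2_ndvd_p ?eqxx //; lia.
Qed.

Lemma card_cyclic_p : #|cyc p| = p.+1.
Proof.
have := card_order gT p; rewrite card_order_p totient_prime //; nia.
Qed.

Lemma card_cyclic_p2 : #|cyc (p ^ 2)| = (p * p.+1)%N.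
Proof.
have := card_order gT (p ^ 2); rewrite card_order_p2 totient_pfactor //=.
rewrite expn1; nia.
Qed.

(** A cyclic group has at most one subgroup of each order. *)
Lemma cyclic_p_sub x y : #[x]%g = (p ^ 2)%N -> #[y]%g = p ->
  (<[y]> \subset <[x]>)%g = (<[y]>%g == <[x ^+ p]>%g).
Proof.
move=> xo yo; apply/idP/eqP=> [yx|->]; last by rewrite cycle_subG mem_cycle.
apply/eqP; rewrite (eq_subG_cyclic (cycle_cyclic x)) ?cycle_subG ?mem_cycle //.
  by rewrite -!orderE yo order_expp.
by rewrite -cycle_subG.
Qed.

(** Double counting of the [x] with [<[x ^+ p]> = <[y]>]: by [<[x]>], each subgroup above [y] has
    [p * p.-1] generators; by [x ^+ p], each of the [p.-1] generators of [<[y]>] has [p ^ 2]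
    roots. *)
Lemma card_cyclic_p2_above y : #[y]%g = p ->
  #|[set H in cyc (p ^ 2) | <[y]>%g \subset H]| = p.
Proof.
move=> yo; set A := [set H in _ | _].
suff: (#|A| * (p * p.-1) = p ^ 2 * p.-1)%N by nia.
transitivity #|[set x : gT | <[x ^+ p]>%g == <[y]>%g]|.
  rewrite -sum_nat_const -[RHS]sum1_card.
  rewrite (partition_big (fun x => <[x]>%g) (mem A)) /= => [|x]; last first.
    rewrite !inE mem_cyclic_subgroups => /eqP xy.
    have xo : #[x]%g = (p ^ 2)%N by apply: order_of_expp; rewrite orderE xy.
    by rewrite xo eqxx cyclic_p_sub // xy eqxx.
  apply: eq_bigr => H; rewrite inE => /andP[HA yH].
  have := card_generators HA; rewrite totient_pfactor //= expn1 mulnC => <-.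
  rewrite -sum1_card; apply: eq_bigl => x; rewrite !inE andbC.
  case: eqP => //= xH; rewrite -xH cyclic_p_sub // in yH.
    by rewrite eq_sym.
  by apply/eqP; rewrite -mem_cyclic_subgroups xH.
rewrite -sum1_card (partition_big (fun x => x ^+ p)%g
  (mem [set z | <[z]>%g == <[y]>%g])) /= => [|x]; last by rewrite !inE.
rewrite (eq_bigr (fun=> p ^ 2)%N) => [|z]; last first.
  rewrite inE => /eqP zy; rewrite -(@card_root_fiber z).
    rewrite -sum1_card; apply: eq_bigl => x; rewrite !inE andbC.
    by case: eqP => //= ->; rewrite zy eqxx.
  by rewrite image_expp inE -order_dvdn orderE zy -orderE yo.
rewrite sum_nat_const (@card_generators _ p) ?mem_cyclic_subgroups ?yo //.
by rewrite totient_prime // mulnC.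
Qed.

(** * The adjacency matrix and its characteristic polynomial at a generic point *)

Variable F : fieldType.
Local Notation UL := (generator_mx gT F (p ^ 2)).
Local Notation UB := (generator_mx gT F p).
Local Notation UR := (identity_mx gT F).
Local Notation Inc := (subset_mx gT F (p ^ 2) p).

(** Off the diagonal the entries vanish because no cyclic subgroup of order [p ^ 2] contains two
    subgroups of order [p]. *)
Lemma subset_mx_tr : Inc^T *m Inc = p%:R%:M.
Proof.
apply/matrixP=> i j; rewrite !mxE.
under eq_bigr do rewrite !mxE -natrM mulnb.
rewrite -(big_enum_val (A := mem (cyc (p ^ 2))) (fun H =>
  (((enum_val i : {set gT}) \subset H)
   && ((enum_val j : {set gT}) \subset H))%:R : F)) /=.
have [x xo ei] := cyclic_subgroupsP _ _ (enum_valP i).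
have [<- | ij] := eqVneq i j.
  rewrite ei mulr1n.
  transitivity (#|[set H in cyc (p ^ 2) | <[x]>%g \subset H]|%:R : F).
    rewrite -sum1_card natr_sum /= big_mkcond [RHS]big_mkcond.
    apply: eq_bigr => H _; rewrite !inE andbb.
    by case: (H \in _); case: (_ \subset _).
  by rewrite card_cyclic_p2_above.
have [y yo ej] := cyclic_subgroupsP _ _ (enum_valP j).
rewrite mulr0n big1 // => _ /cyclic_subgroupsP[z zo ->].
rewrite ei ej !cyclic_p_sub //; case: eqP => //= xz; case: eqP => //= yz.
by case/eqP: ij; apply: enum_val_inj; rewrite ei ej xz.
Qed.

(** The only subgroup of order [p] in [<[x]>] is [<[x ^+ p]>]. *)
Lemma subset_mx1 :
  Inc *m (const_mx 1 : 'cV_#|cyc p|) = const_mx 1 :> 'cV_#|cyc (p ^ 2)|.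
Proof.
apply/matrixP=> i j; rewrite !mxE.
under eq_bigr do rewrite !mxE mulr1.
rewrite -(big_enum_val (A := mem (cyc p)) (fun H =>
  (H \subset (enum_val i : {set gT}))%:R : F)) /=.
have /cyclic_subgroupsP[x xo ->] := enum_valP i.
have xpA : <[x ^+ p]>%g \in cyc p by rewrite mem_cyclic_subgroups order_expp.
rewrite (bigD1 _ xpA) /= cycle_subG mem_cycle big1 ?addr0 // => H.
case/andP=> /cyclic_subgroupsP[y yo ->].
by rewrite cyclic_p_sub // => /negPf->.
Qed.

Lemma adjacency_rooted :
  adjacency_mx F (@power_graph gT) = rooted_mx UL UB UR Inc - 1%:M.
Proof.
have p1 : (p == 1%N) = false by lia.
have p21 : (p ^ 2 == 1)%N = false by lia.
have p1' : (1%N == p) = false by lia.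
have p21' : (1 == p ^ 2)%N = false by lia.
have pp2 : (p == p ^ 2)%N = false by lia.
have p2p : (p ^ 2 == p)%N = false by lia.
apply/eqP; rewrite eq_sym subr_eq eq_sym; apply/eqP/matrixP=> i j.
rewrite /rooted_mx.
have -> : UB *m Inc^T *m UL^T = (UL *m Inc *m UB^T)^T.
  by rewrite !trmx_mul trmxK mulmxA.
have -> (k : nat) (A : 'M_(_, k)) :
    UR *m (const_mx 1 : 'cV_k)^T *m A^T
    = (A *m const_mx 1 *m UR^T)^T.
  by rewrite !trmx_mul trmxK mulmxA.
(* Each rewrite instantiates [A] only once, so one pass serves [UL] and the other [UB]. *)
have -> (k : nat) (A : 'M_(_, k)) :
    UR *m (const_mx 1 : 'cV_k)^T *m A^T
    = (A *m const_mx 1 *m UR^T)^T.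
  by rewrite !trmx_mul trmxK mulmxA.
have root k i' j' : (generator_mx gT F k *m const_mx 1 *m UR^T) i' j'
    = ((#[enum_val i']%g == k) && (enum_val j' == 1%g))%:R.
  by rewrite mxE big_ord1 generator_mx1 !mxE -natrM mulnb.
have corner i' j' : (UR *m UR^T) i' j'
    = ((enum_val i' == 1%g) && (enum_val j' == 1%g))%:R.
  by rewrite mxE big_ord1 !mxE -natrM mulnb.
have mxD m n (A B : 'M[F]_(m, n)) i' j' : (A + B) i' j' = A i' j' + B i' j'.
  by rewrite mxE.
have mxT m n (A : 'M[F]_(m, n)) i' j' : A^T i' j' = A j' i' by rewrite mxE.
rewrite !mxD !mxT !root corner !generator_mx_mul_tr !generator_subset_mx !mxE.
rewrite power_graphE -(inj_eq enum_val_inj) -!order_eq1.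
move: (enum_val i) (enum_val j) => x y.
(* Adding the identity matrix absorbs the condition that adjacent vertices differ. *)
have -> : ((x != y) && ((<[x]> \subset <[y]>) || (<[y]> \subset <[x]>)))%g%:R
    + (x == y)%:R = ((<[x]> \subset <[y]>) || (<[y]> \subset <[x]>))%g%:R :> F.
  by have [->|] := eqVneq x y; rewrite ?subxx ?addr0 // add0r.
have lt_xy := @cycle_sub_ltF gT x y; have lt_yx := @cycle_sub_ltF gT y x.
have eq_xy := @cycle_sub_eq gT x y; have eq_yx := @cycle_sub_eq gT y x.
have neq_xy := @cycle_eqF gT x y; have x1 := @cycle_sub1 gT x y.
have y1 := @cycle_sub1 gT y x; rewrite [_ == <[x]>%g]eq_sym in eq_yx *.
(* From here only the truth values of the three relations matter; for each of the nine pairs of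
   orders, the facts collected above exclude the inconsistent assignments. *)
move: (<[x]> \subset <[y]>)%g (<[y]> \subset <[x]>)%g (<[x]>%g == <[y]>%g)
  lt_xy lt_yx eq_xy eq_yx neq_xy x1 y1 => sxy syx exy.
have [[-> | -> | ->] [-> | -> | ->]] := (order_cases x, order_cases y).
all: rewrite ?eqxx ?p1 ?p21 ?p1' ?p21' ?pp2 ?p2p.
all: case: sxy; case: syx; case: exy => /= *.
all: rewrite ?addr0 ?add0r ?mulr1n //; exfalso; lia.
Qed.

(** The shift [x + 1] appears because [rooted_mx] is the adjacency matrix plus the identity. The
    three conditions keep the pivots of the eliminations nonzero; [D] is the product of the two
    Schur pivots. *)
Lemma horner_char_poly_power_graph (x : F) :
  let P := p%:R : F in
  let D := (x + 1 - (P - 1)) * (x + 1 - P * (P - 1)) - P ^+ 2 * (P - 1) ^+ 2 in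
  x + 1 != 0 -> x + 1 - P * (P - 1) != 0 -> D != 0 ->
  (char_poly (adjacency_mx F (@power_graph gT))).[x] =
    (x + 1) ^+ (p ^ 4 - p ^ 2 - 2 * p - 2)
    * (x + 1 - P * (P - 1)) ^+ (p ^ 2 - 1) * D ^+ p
    * (x ^+ 3 + (3%:R - P ^+ 2) * x ^+ 2
       + (- 2%:R * P ^+ 4 + 3%:R * P ^+ 3 - 4%:R * P ^+ 2 + P + 3%:R) * x
       + (- P ^+ 5 + P ^+ 4 - 2%:R * P ^+ 2 + P + 1)).
Proof.
move=> P D t0 tq0 D0.
have natm : (totient p)%:R = P - 1 :> F.
  by rewrite totient_prime // -subn1 natrB ?prime_gt0.
have natq : (totient (p ^ 2))%:R = P * (P - 1) :> F.
  by rewrite totient_pfactor //= expn1 natrM -natm totient_prime // mulrC.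
have p2p : (p ^ 2 != p)%N by lia.
rewrite horner_char_poly adjacency_rooted opprB addrA -raddfD /=.
set t := x + 1 in t0 tq0 D D0 *; set q := P * (P - 1) in tq0 D D0 *.
pose d := t - (P - 1) - P * q * (P - 1) / (t - q).
have dE : (t - q) * d = D by rewrite /d /D /q; field.
have d0 : d != 0 by apply: contraNneq D0; rewrite -dE => ->; rewrite mulr0.
have p21 : (p ^ 2 != 1)%N by lia.
have p1 : (p != 1)%N by lia.
have hL : UL^T *m UL = q%:M by rewrite generator_mx_tr natq.
have hB : UB^T *m UB = (P - 1)%:M by rewrite generator_mx_tr natm.
have := det_rooted_mx hL hB (identity_mx_tr gT F) (generator_mx_tr0 gT F p2p)
  (generator_mx_tr_identity gT F p21) (generator_mx_tr_identity gT F p1)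
  subset_mx_tr subset_mx1 t0 tq0 d0.
rewrite -/d; move: (\det _) => delta.
rewrite card_cyclic_p card_cyclic_p2 cardG.
set N := (p ^ 4 - _ - _ - _)%N.
(* There are [p * p.+1 + p.+1 + 1] cyclic subgroups, and [N] is the rest of [p ^ 4]; the truncated
   subtraction is exact as [p] is at least 2. *)
have -> : (p ^ 4 = p * p.+1 + (p.+1 + 1) + N)%N.
  by rewrite /N; nia.
move=> detE; apply: (mulfI (expf_neq0 (p * p.+1 + (p.+1 + 1)) t0)).
rewrite {}detE [t ^+ (_ + N)]exprD -!mulrA; do 2 congr (_ * _).
(* Of the factors [t - q], [p + 1] pair with the factors [d] to give [D ^+ p.+1]. One [D] is kept
   aside to clear the denominators of the last factor, which becomes the cubic. *)
have -> : (p * p.+1 = (p ^ 2 - 1) + (p + 1))%N by nia.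
rewrite exprD -mulrA; congr (_ * _).
rewrite addn1 mulrA -exprMn dE exprSr -mulrA; congr (_ * _).
have -> : (p.+1)%:R = P + 1 by rewrite natr1.
rewrite -dE; transitivity ((t - q) * d * (t - 1 - P * (P + 1) * q / (t - q))
  - (t - q) * ((P + 1) * (P - 1) * (1 + P * q / (t - q)) ^+ 2)).
  by rewrite -/P; rewrite /q in tq0 *; clearbody d; field; rewrite tq0 d0.
by rewrite dE /D /q /t; field.
Qed.
End Homocyclic.

(** * From generic values to the multiset of eigenvalues *)

(** Otherwise [(f - g) * h] is nonzero and, over a closed field, has a non-root, where [f] and [g]
    differ although [h] does not vanish. *)
Lemma poly_eq_cofinite (F : closedFieldType) (f g h : {poly F}) : h != 0 ->
  (forall x, h.[x] != 0 -> f.[x] = g.[x]) -> f = g.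
Proof.
move=> h0 fg; apply/eqP; rewrite -subr_eq0; apply: contraT => fg0.
have /closed_nonrootP[x] : (f - g) * h != 0 by rewrite mulf_neq0.
rewrite rootM negb_or => /andP[/negP + /fg fgx].
by rewrite /root hornerD hornerN fgx subrr eqxx.
Qed.

Lemma roots_multE (F : closedFieldType) (f : {poly F}) : f \is monic ->
  f = \prod_(z <- roots_mult f) ('X - z%:P).
Proof.
rewrite /roots_mult; case: closed_field_poly_normal => r /= fr /monicP f1.
by rewrite {1}fr f1 scale1r.
Qed.

Lemma prod_nseq (R : comNzRingType) (n : nat) (a : R) :
  \prod_(z <- nseq n a) ('X - z%:P) = ('X - a%:P) ^+ n.
Proof. by rewrite big_nseq iter_mulr_1. Qed.

Lemma monic_cubic (R : nzRingType) (a b c : R) :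
  'X^3 + a%:P * 'X^2 + b%:P * 'X + c%:P \is monic.
Proof.
rewrite -!addrA monicE lead_coefDl ?lead_coefXn // size_polyXn ltnS !mul_polyC.
rewrite !(leq_trans (size_polyD _ _)) // geq_max.
rewrite (leq_trans (size_scale_leq _ _)) ?size_polyXn //=.
rewrite (leq_trans (size_polyD _ _)) // geq_max.
rewrite (leq_trans (size_scale_leq _ _)) ?size_polyX //=.
by rewrite (leq_trans (size_polyC_leq1 _)).
Qed.

Theorem power_graph_spectrum (C : numClosedFieldType) (gT : finGroupType)
    (p : nat) : prime p -> (forall x y : gT, (x * y = y * x)%g) ->
    #|gT| = (p ^ 4)%N -> (forall x : gT, (x ^+ (p ^ 2) = 1)%g) ->
    #|[set x : gT | x ^+ p == 1]%g| = (p ^ 2)%N ->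
  let P : C := p%:R in
  let s : C := sqrtC (5%:R * P ^+ 2 - 2%:R * P + 1) in
  is_true (perm_eq
    (graph_spectrum C (@power_graph gT))
    (nseq (p ^ 4 - p ^ 2 - 2 * p - 2)%N (- 1)
     ++ nseq (p ^ 2 - 1)%N (P ^+ 2 - P - 1)
     ++ nseq p ((P ^+ 2 + (P - 1) * s - 3%:R) / 2%:R)
     ++ nseq p ((P ^+ 2 - (P - 1) * s - 3%:R) / 2%:R)
     ++ roots_mult
          ('X^3 + (3%:R - P ^+ 2)%:P * 'X^2
           + (- 2%:R * P ^+ 4 + 3%:R * P ^+ 3 - 4%:R * P ^+ 2 + P + 3%:R)%:P
             * 'X
           + (- P ^+ 5 + P ^+ 4 - 2%:R * P ^+ 2 + P + 1)%:P))).
Proof.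
move=> p_prime mulgC cardG expG cardK P s.
have s2 : s ^+ 2 = 5%:R * P ^+ 2 - 2%:R * P + 1 by rewrite sqrtCK.
set l1 := (_ + _ - 3%:R) / _; set l2 := (_ - _ - 3%:R) / _.
(* Two lists are permutations of each other as soon as the products of their linear factors
   agree. *)
apply: prod_XsubC_eq; rewrite -roots_multE ?char_poly_monic //.
rewrite !big_cat -roots_multE ?monic_cubic //= !prod_nseq.
(* The roots of this product are the excluded points [x + 1 = 0], [x + 1 = P * (P - 1)] and
   [D = 0]. *)
apply: (@poly_eq_cofinite _ _ _
  (('X - (-1)%:P) * ('X - (P ^+ 2 - P - 1)%:P)
   * (('X - l1%:P) * ('X - l2%:P)))).
  by rewrite !mulf_neq0 ?polyXsubC_eq0.
move=> x.
(* [l1] and [l2] are the roots of the quadratic [D]; the square root enters only through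
   [s ^+ 2]. *)
have l12 : (x - l1) * (x - l2) =
    (x + 1 - (P - 1)) * (x + 1 - P * (P - 1)) - P ^+ 2 * (P - 1) ^+ 2.
  transitivity (x ^+ 2 - (P ^+ 2 - 3%:R) * x
     + ((P ^+ 2 - 3%:R) ^+ 2 - (P - 1) ^+ 2 * s ^+ 2) / 4%:R).
    by rewrite /l1 /l2; field.
  by rewrite s2; field.
rewrite !hornerM !hornerXsubC l12 opprK => h.
have qE : x - (P ^+ 2 - P - 1) = x + 1 - P * (P - 1) by ring.
move: h; rewrite qE !mulf_eq0 !negb_or => /andP[/andP[t0 tq0] D0].
rewrite (horner_char_poly_power_graph p_prime) //.
rewrite -/P -l12 exprMn !(hornerM, horner_exp, hornerXsubC) opprK qE.
by rewrite !(hornerXn, hornerD, hornerM, hornerX, hornerC) !mulrA.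
Qed.

(** * The group ['Z_(p ^ 2) * 'Z_(p ^ 2)] meets the hypotheses *)

(** Multiplication by [d] is a bijection from ['I_m] onto these multiples. *)
Lemma card_ord_dvdn (d m n : nat) : (0 < d)%N -> n = (d * m)%N ->
  #|[set a : 'I_n | (d %| a)%N]| = m.
Proof.
move=> d_gt0 ->; rewrite -[RHS]card_ord.
have lt_di (i : 'I_m) : (d * i < d * m)%N by rewrite ltn_pmul2l.
rewrite -[RHS](card_imset _ (_ : injective (fun i => Ordinal (lt_di i)))).
  apply: eq_card => a; rewrite inE.
  apply/idP/imsetP=> [/dvdnP[k ak] | [i _ ->]].
    have ltk : (k < m)%N by have := ltn_ord a; rewrite ak mulnC ltn_pmul2l.
    by exists (Ordinal ltk) => //; apply: val_inj; rewrite /= ak mulnC.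
  by rewrite /= dvdn_mulr.
move=> i j /(congr1 val) /= /eqP; rewrite eqn_pmul2l // => /eqP.
exact: val_inj.
Qed.

Section ZpSquare.
Variable p : nat.
Hypothesis p_prime : prime p.
Local Notation G := ('Z_(p ^ 2) * 'Z_(p ^ 2))%type.

(** ['Z_n] has [n] elements only when [n] exceeds 1, which [Zp_cast] requires. *)
Let p2_gt1 : (1 < p ^ 2)%N.
Proof. by rewrite -(exp1n 2) ltn_exp2r // prime_gt1. Qed.

Lemma expg_pairZp (x : G) k : (x ^+ k)%g = (x.1 *+ k, x.2 *+ k).
Proof.
elim: k => [|k IHk]; first by rewrite expg0 !mulr0n.
by rewrite expgS IHk !mulrS.
Qed.

Lemma card_ZpSquare : #|{: G}| = (p ^ 4)%N.
Proof. by rewrite card_prod !card_ord Zp_cast // -expnD. Qed.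

Lemma expg_ZpSquare (x : G) : (x ^+ (p ^ 2))%g = 1%g.
Proof.
have pchar a : a *+ (p ^ 2) = 0 :> 'Z_(p ^ 2).
  by rewrite -mulr_natr pchar_Zp ?mulr0.
by rewrite expg_pairZp !pchar.
Qed.

Lemma mulrn_Zp_eq0 (a : 'Z_(p ^ 2)) : (a *+ p == 0) = (p %| a)%N.
Proof.
rewrite Zp_mulrn -val_eqE /=; move: (nat_of_ord a) => n.
rewrite Zp_cast // -/(dvdn _ _) expnS expn1.
by rewrite dvdn_pmul2r // prime_gt0.
Qed.

(** Being killed by [p] is a condition on each coordinate, met by the [p] multiples of [p]. *)
Lemma card_kernel_ZpSquare : #|[set x : G | (x ^+ p)%g == 1%g]| = (p ^ 2)%N.
Proof.
pose A := [set a : 'Z_(p ^ 2) | (p %| a)%N].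
have cA : #|A| = p.
  by apply: card_ord_dvdn; rewrite ?prime_gt0 ?Zp_cast.
transitivity #|setX A A|; last by rewrite cardsX cA.
apply: eq_card => -[a b].
by rewrite !inE /= expg_pairZp xpair_eqE !mulrn_Zp_eq0.
Qed.

End ZpSquare.

Theorem theorem4p2 (C : numClosedFieldType) (p : nat) (hp : prime p) :
  let P : C := p%:R in
  let s : C := sqrtC (5%:R * P ^+ 2 - 2%:R * P + 1) in
  is_true (perm_eq
    (graph_spectrum C (@power_graph ('Z_(p ^ 2) * 'Z_(p ^ 2))%type))
    (nseq (p ^ 4 - p ^ 2 - 2 * p - 2)%N (- 1)
     ++ nseq (p ^ 2 - 1)%N (P ^+ 2 - P - 1)
     ++ nseq p ((P ^+ 2 + (P - 1) * s - 3%:R) / 2%:R)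
     ++ nseq p ((P ^+ 2 - (P - 1) * s - 3%:R) / 2%:R)
     ++ roots_mult
          ('X^3 + (3%:R - P ^+ 2)%:P * 'X^2
           + (- 2%:R * P ^+ 4 + 3%:R * P ^+ 3 - 4%:R * P ^+ 2 + P + 3%:R)%:P
             * 'X
           + (- P ^+ 5 + P ^+ 4 - 2%:R * P ^+ 2 + P + 1)%:P))).
Proof.
apply: power_graph_spectrum => //.
- by move=> [a b] [c d]; congr pair; apply: addrC.
- exact: card_ZpSquare.
- exact: expg_ZpSquare.
- exact: card_kernel_ZpSquare.
Qed.
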